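(* Let $p$ be an odd prime, $n\ge 1$ and $1\le k\le n$. If $N\trianglelefteq W_n$ is a normal subgroup such that $N\subseteq B_k\cdots B_n$ and $N\not\subseteq B_{k+1}\cdots B_n$, then $N$ contains $\gamma_{p^{k-1}+1}(W_n)$ and $$|N:\gamma_{p^{k-1}+1}(W_n)|\le \bigl(p^{p^{k-1}}\bigr)^{n-k+1}.$$ In particular this index is bounded above by a function depending only on $p$ and $k$.
   Context: Let $p$ be an odd prime and $n\ge 1$ an integer. For $1\le k\le n$ let $B_k=\mathrm{Fun}(\mathbb{F}_p^{k-1},\mathbb{F}_p)$ (additive group; $B_1=\mathbb{F}_p$). Write $f\Delta_k$ for $f$ regarded as an element of $B_k$. The element $f\Delta_k$ acts on $\mathbb{F}_p^n$ as the permutation $x\mapsto x-f(x_1,\dots,x_{k-1})e_k$, where $e_k$ is the $k$-th canonical basis vector. $W_n$ is the subgroup of $\mathrm{Sym}(\mathbb{F}_p^n)$ generated by $B_1,\dots,B_n$ (the $n$-fold iterated wreath product of $\mathbb{F}_p$, a Sylow $p$-subgroup of $\mathrm{Sym}(p^n)$). For each $k$ the product $B_k\cdots B_n$ is a normal subgroup of $W_n$; for $k=n$ the product $B_{k+1}\cdots B_n$ is the trivial subgroup. The lower central series is $\gamma_1(W_n)=W_n$, $\gamma_{i+1}(W_n)=[\gamma_i(W_n),W_n]$.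
   Formalization: The final bound is proved by a function that may also depend on n, not only on p and k: for k = 1 and N = W_n the index of γ_2(W_n) is p^n, so no function of p and k alone bounds it. *)

(* Defs.v *)
From HB Require Import structures.
From mathcomp Require Import all_boot all_order all_algebra all_fingroup all_solvable.

Set Implicit Arguments.
Unset Strict Implicit.
Unset Printing Implicit Defensive.

Import GroupScope GRing.Theory.

(* Coordinates are indexed by 'I_n, i.e. from 0: the ordinal i below stands for
   the 1-based level k = i.+1, so that 'rV['F_p]_i is F_p^(k-1).
   Every use of 'F_p assumes p prime. *)

(* (x_1, ..., x_(k-1)) for k = i.+1 *)
Definition prefix (p n : nat) (i : 'I_n) (x : 'rV['F_p]_n) : 'rV['F_p]_i :=
  \row_(j < i) x ord0 (widen_ord (ltnW (ltn_ord i)) j).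

Definition Delta_fun (p n : nat) (i : 'I_n) (f : {ffun 'rV['F_p]_i -> 'F_p})
    (x : 'rV['F_p]_n) : 'rV['F_p]_n :=
  (x - f (prefix i x) *: delta_mx ord0 i)%R.

Lemma Delta_fun_inj (p n : nat) (i : 'I_n) (f : {ffun 'rV['F_p]_i -> 'F_p}) :
  injective (Delta_fun f).
Proof.
move=> x y exy.
have pK z : prefix i (Delta_fun f z) = prefix i z.
  apply/rowP => j; rewrite !mxE eqxx /=.
  by rewrite -val_eqE /= (ltn_eqF (ltn_ord j)) mulr0 subr0.
have exy' : prefix i x = prefix i y by rewrite -pK exy pK.
by move: exy; rewrite /Delta_fun exy' => /addIr.
Qed.

Definition Delta (p n : nat) (i : 'I_n) (f : {ffun 'rV['F_p]_i -> 'F_p}) :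
    {perm 'rV['F_p]_n} :=
  perm (@Delta_fun_inj p n i f).

(* B_k, k = i.+1, as a subset of Sym(F_p^n) *)
Definition baseB (p n : nat) (i : 'I_n) : {set {perm 'rV['F_p]_n}} :=
  [set Delta f | f : {ffun 'rV['F_p]_i -> 'F_p}].

Definition iterW (p n : nat) : {group {perm 'rV['F_p]_n}} :=
  <<\bigcup_(i < n) baseB p i>>%G.

(* The set product B_k B_(k+1) ... B_n, with k counted from 1; it is the empty
   product 1 when k = n.+1. *)
Definition tailB (p n k : nat) : {set {perm 'rV['F_p]_n}} :=
  \prod_(i < n | k <= i.+1) baseB p i.

(* Main.v *)
Require Import Defs.
From HB Require Import structures.
From mathcomp Require Import all_boot all_order all_algebra all_fingroup all_solvable.
From mathcomp Require Import ring zify.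

Set Implicit Arguments.
Unset Strict Implicit.
Unset Printing Implicit Defensive.

Import GroupScope GRing.Theory.

(** The group [W_n] consists of the permutations of the vectors whose [i]-th
    tableau entry, the displacement of the coordinate [x_i] (counted from 0),
    depends on the previous coordinates only. It acts on functions with values
    in ['F_p], and the proof measures everything by one filtration of this
    function space.

    Let [s] be the odometer, an element of [W_n] that permutes all vectors in a
    single cycle. In characteristic [p] the operator [s - 1] is one nilpotent
    Jordan block, so the kernels of its powers ([stratum]) form the unique
    chain of subspaces stable under [s - 1] ([stratum_sub_diff_stable]). The
    functions of the first [k] coordinates are one of these kernels, that of
    the power [p ^ k] ([depends_stratum]), and [x_k] lies in the next one
    ([coord_stratum]). As [W_n] is a [p]-group, every element lowers the
    filtration by at least one ([stratum_lower]), so elements of the [c]-th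
    term of the lower central series lower it by at least [c]
    ([lcn_lowering]).

    Write [B_i], [i] from 0, for the abelian layers and [tail i] for the product
    of the layers from [i] on. Let [core i] be the set of elements whose [j]-th
    entry is killed by the power [p ^ j - p ^ i] of [s - 1], for all [j]. Applied
    to the coordinates, the previous estimate shows that [core i] contains the
    term [p ^ i + 1] of the lower central series. Elements of [tail i] preserve
    sums over the fibres of the first [i] coordinates, whence
    [[tail i, tail i] <= core i] ([tail_commg_core]).

    Conversely let [N] be normal, inside [tail i] but not inside [tail i.+1]. An
    element of [N] moving [x_i] produces, by a duality argument
    ([tail_not_lower]), commutators of the largest possible degree in each layer
    after the [i]-th, and as submodules form a chain, [[N, tail i.+1]] contains
    [core i] ([core_sub_commg]). Applying this to the given [N] shows that [N]
    contains [core i]; applying it to the intersection of [tail i] with the term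
    [p ^ i] of the lower central series shows that [core i] is the next term.
    Finally [core i] has codimension at most [p ^ i] in each of the [n - i]
    layers of [tail i], which bounds the index. *)

(** * Finite differences along a permutation *)

Section Unipotent.

Local Open Scope ring_scope.

Variables (p : nat) (T : finType).
Local Notation V := {ffun T -> 'F_p}.

Definition act (g : {perm T}) (u : V) : V := [ffun x => u (g x)].

Lemma actM g h u : act (g * h)%g u = act g (act h u).
Proof. by apply/ffunP=> x; rewrite !ffunE permM. Qed.

Lemma act1 u : act 1%g u = u.
Proof. by apply/ffunP=> x; rewrite ffunE perm1. Qed.

Lemma actK g : cancel (act g) (act g^-1%g).
Proof. by move=> u; rewrite -actM mulVg act1. Qed.

Lemma actKV g : cancel (act g^-1%g) (act g).
Proof. by move=> u; rewrite -actM mulgV act1. Qed.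

Lemma actB g : {morph act g : u v / u - v}.
Proof. by move=> u v; apply/ffunP=> x; rewrite !ffunE. Qed.

Lemma actMr g : {morph act g : u v / u * v}.
Proof. by move=> u v; apply/ffunP=> x; rewrite !ffunE. Qed.

Lemma act0 g : act g 0 = 0.
Proof. by apply/ffunP=> x; rewrite !ffunE. Qed.

Definition diff (g : {perm T}) (u : V) : V := act g u - u.

Lemma diffB g : {morph diff g : u v / u - v}.
Proof. by move=> u v; apply/ffunP=> x; rewrite /diff !ffunE; ring. Qed.

Lemma diffD g : {morph diff g : u v / u + v}.
Proof. by move=> u v; apply/ffunP=> x; rewrite /diff !ffunE; ring. Qed.

Lemma diff0 g : diff g 0 = 0.
Proof. by rewrite /diff act0 subr0. Qed.

Lemma diff_mul g u v :
  diff g (u * v) = diff g u * v + u * diff g v + diff g u * diff g v.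
Proof.
by apply/ffunP=> x; rewrite /diff actMr !ffunE; ring.
Qed.

(** In the group algebra, [[g, h] - 1 = (hg)^-1 (gh - hg)], and [gh - hg] is the
    Lie bracket of [g - 1] and [h - 1]. This is how group commutators are
    estimated by iterated differences. *)
Lemma diff_commg g h u :
  diff [~ g, h] u =
    act (g^-1 * h^-1)%g (diff g (diff h u) - diff h (diff g u)).
Proof.
have -> : diff g (diff h u) - diff h (diff g u) = act (g * h)%g u - act (h * g)%g u.
  by rewrite /diff !actB !actM; apply/ffunP=> x; rewrite !ffunE; ring.
rewrite actB -!actM /diff commgEl /conjg -!mulgA; congr (_ - _).
by rewrite mulKg mulVg act1.
Qed.

Variable s : {perm T}.
Local Notation D := (diff s).

Lemma iter_diffB i : {morph iter i D : u v / u - v}.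
Proof. by elim: i => // i IH u v; rewrite !iterS IH diffB. Qed.

Lemma iter_diffD i : {morph iter i D : u v / u + v}.
Proof. by elim: i => // i IH u v; rewrite !iterS IH diffD. Qed.

Lemma iter_diff0 i : iter i D 0 = 0.
Proof. by elim: i => // i IH; rewrite iterS IH diff0. Qed.

Lemma iter_diffMn i u k : iter i D (u *+ k) = iter i D u *+ k.
Proof.
by elim: k => [|k IH]; rewrite ?mulr0n ?iter_diff0 // !mulrS iter_diffD IH.
Qed.

(** Functions of degree less than [i] in the sense of finite differences along
    [s]; for the odometer below they are the polynomial functions of weight
    less than [i], where the coordinate [x_j], counted from 0, weighs [p ^ j]. *)
Definition stratum i : {set V} := [set u | iter i D u == 0].
Local Notation L := stratum.

Lemma stratumP i u : reflect (iter i D u = 0) (u \in L i).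
Proof. by rewrite inE; exact: eqP. Qed.

Lemma stratum0 u : (u \in L 0) = (u == 0).
Proof. by rewrite inE. Qed.

Lemma stratumB i u v : u \in L i -> v \in L i -> u - v \in L i.
Proof.
by move=> /stratumP u0 /stratumP v0; apply/stratumP; rewrite iter_diffB u0 v0 subr0.
Qed.

Lemma stratum_zero i : 0 \in L i.
Proof. by apply/stratumP; rewrite iter_diff0. Qed.

Lemma stratumN i u : u \in L i -> - u \in L i.
Proof. by move=> uL; rewrite -[- u]add0r stratumB ?stratum_zero. Qed.

Lemma stratumD i u v : u \in L i -> v \in L i -> u + v \in L i.
Proof. by move=> uL vL; rewrite -[v]opprK stratumB ?stratumN. Qed.

Lemma stratum_leq i j u : (i <= j)%N -> u \in L i -> u \in L j.
Proof.
by move=> /subnK<- /stratumP u0; apply/stratumP; rewrite iterD u0 iter_diff0.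
Qed.

Lemma stratum_diff i u : (D u \in L i) = (u \in L i.+1).
Proof. by rewrite !inE -iterSr. Qed.

(** Degrees add up, by the Leibniz rule [diff_mul]. *)
Lemma stratum_mul a b u v :
  u \in L a.+1 -> v \in L b.+1 -> u * v \in L (a + b).+1.
Proof.
have [k le_abk] := ubnP (a + b); elim: k => // k IH in a b u v le_abk *.
move=> uL vL; rewrite -stratum_diff diff_mul.
have DuL : D u \in L a by rewrite stratum_diff.
have DvL : D v \in L b by rewrite stratum_diff.
have kill w : (w \in L 0) -> w = 0 by rewrite stratum0 => /eqP.
have uDv : u * D v \in L (a + b).
  case: b DvL {vL} le_abk => [/kill->|b DvL] le; first by rewrite mulr0 stratum_zero.
  by rewrite addnS; apply: IH; rewrite // -addnS.
case: a DuL uL le_abk uDv => [/kill->|a DuL] uL le uDv.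
  by rewrite !mul0r add0r addr0.
rewrite addSn; apply: stratumD; first by apply: stratumD; first exact: IH.
case: b DvL {vL uDv} le => [/kill->|b DvL] le; first by rewrite mulr0 stratum_zero.
apply: (@stratum_leq (a + b).+1); first by lia.
by apply: IH; lia.
Qed.

Lemma Fp_mulrn_surj (a b : 'F_p) : b != 0 -> exists k : nat, a = b *+ k.
Proof.
move=> b0; exists (nat_of_ord (a / b)); rewrite -mulr_natr.
by rewrite natr_Zp mulrC divfK.
Qed.

Hypothesis s_trans : forall x y, exists i, ((s ^+ i)%g x) = y.

Lemma diff_const u x y : D u = 0 -> u x = u y.
Proof.
move/eqP; rewrite subr_eq0 => /eqP su.
have [i <-] := s_trans x y.
have -> : u ((s ^+ i)%g x) = act (s ^+ i)%g u x by rewrite ffunE.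
congr (fun_of_fin _ x).
by elim: i => [|i IH]; rewrite ?act1 // expgS actM -IH.
Qed.

Lemma iter_diff_const i u x y :
  u \in L i.+1 -> iter i D u x = iter i D u y.
Proof. by move/stratumP; rewrite iterS => /diff_const; apply. Qed.

(** Uniseriality of the function space. A transitive [s] fixes only the
    constants, so iterating the difference on a function of exact degree [i]
    meets every smaller degree and ends with a nonzero constant; subtracting
    multiples of these iterates reduces any function of degree at most [i]
    to zero. *)
Lemma stratum_sub_diff_stable (S : V -> Prop) i v N :
  (forall u w, S u -> S w -> S (u - w)) -> (forall u, S u -> S (D u)) ->
  S v -> v \in L N -> v \notin L i ->
  forall u, u \in L i.+1 -> S u.
Proof.
move=> SB SD.
have S0 w : S w -> S 0 by move=> Sw; rewrite -(subrr w); exact: SB.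
have SMn w k : S w -> S (w *+ k).
  move=> Sw; elim: k => [|k IH]; first exact: S0 Sw.
  rewrite mulrSr -[w in _ + w]opprK; apply: (SB) => //.
  by rewrite -sub0r; apply: (SB) => //; exact: S0 Sw.
move=> Sv vN vi.
(* Applying [D] often enough brings the degree of [v] down to exactly [i]. *)
have {v N Sv vN vi} [v [Sv vi vi1]] : exists v, [/\ S v, v \notin L i & v \in L i.+1].
  elim: N v Sv vN vi => [|N IH] v Sv vN vi.
    by rewrite (stratum_leq _ vN) in vi.
  case: (boolP (v \in L i.+1)) => vi1; first by exists v.
  by apply: (IH (D v)); rewrite ?stratum_diff //; exact: SD.
have reduce j w z : S w -> w \notin L j -> w \in L j.+1 -> z \in L j.+1 ->
    exists2 k : nat, S (w *+ k) & z - w *+ k \in L j.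
  move=> Sw; rewrite inE => /eqP/ffunP wj wj1 zj1.
  have [x wx] : exists x, iter j D w x != 0.
    apply/existsP; apply: contraT; rewrite negb_exists => /forallP w0.
    by case: wj => x; move/negbNE/eqP: (w0 x) => ->; rewrite ffunE.
  have [k zw] := Fp_mulrn_surj (iter j D z x) wx.
  exists k; first exact: SMn.
  rewrite inE; apply/eqP/ffunP=> y; rewrite iter_diffB iter_diffMn.
  move: zw (iter_diff_const y x zj1) (iter_diff_const y x wj1).
  move: (iter j D z) (iter j D w) => z' w' zw zyx wyx.
  by rewrite 2!ffunE ffunMnE zyx wyx zw ffunE subrr.
elim: i v Sv vi vi1 => [|i IH] v Sv vi vi1 u ui1.
all: have [k Sk uk] := reduce _ _ _ Sv vi vi1 ui1.
all: have -> : u = u - v *+ k - (0 - v *+ k) by rewrite sub0r opprK addrNK.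
all: apply: (SB); last by apply: (SB) => //; exact: S0 Sv.
- by rewrite stratum0 in uk; rewrite (eqP uk); exact: S0 Sv.
apply: IH uk; first exact: SD Sv; by rewrite stratum_diff.
Qed.

Hypothesis p_pr : prime p.

(** The last nonzero difference is a constant function, hence has [p] possible
    values, and it determines the function up to smaller degree. *)
Lemma card_stratumS i : (#|L i.+1| <= p * #|L i|)%N.
Proof.
have [x0 _ | T0] := pickP T; last first.
  have V1 (u v : V) : u = v by apply/ffunP=> x; have := T0 x.
  have all0 u j : u \in L j by rewrite (V1 u 0) stratum_zero.
  rewrite (eq_card (_ : L i.+1 =i L i)); last by move=> u; rewrite !all0.
  by rewrite leq_pmull ?prime_gt0.
have -> : #|L i.+1| = (\sum_(c : 'F_p) #|[set u in L i.+1 | iter i D u x0 == c]|)%N.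
  rewrite -sum1_card (partition_big (fun u : V => iter i D u x0) predT) //=.
  by apply: eq_bigr => c _; rewrite -sum1_card; apply: eq_bigl => u; rewrite inE.
rewrite -[p in (p * _)%N](card_Fp p_pr) -sum_nat_const; apply: leq_sum => c _.
have [->|[v]] := set_0Vmem [set u in L i.+1 | iter i D u x0 == c].
  by rewrite cards0.
rewrite inE => /andP[v1 /eqP vc].
rewrite -(card_imset _ (addIr (- v))).
apply/subset_leq_card/subsetP=> _ /imsetP[u + ->].
rewrite inE => /andP[u1 /eqP uc]; rewrite inE; apply/eqP/ffunP=> x.
move: uc vc (iter_diff_const x x0 u1) (iter_diff_const x x0 v1); rewrite iter_diffB.
move: (iter i D u) (iter i D v) => u' v' uc vc ux vx.
by rewrite !ffunE ux vx uc vc subrr.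
Qed.

Lemma card_stratum_leq i k : (#|L (k + i)| <= p ^ k * #|L i|)%N.
Proof.
elim: k => [|k IH]; first by rewrite mul1n.
by rewrite (leq_trans (card_stratumS _)) // expnS -mulnA leq_mul2l IH orbT.
Qed.

(** The action of the group algebra of [<[s]>], with [s] written as ['X];
    identities of polynomials thereby become identities of difference
    operators. *)
Definition polyact (P : {poly 'F_p}) (u : V) : V :=
  [ffun x => \sum_(i < size P) P`_i * u ((s ^+ i)%g x)].

Lemma polyactE N (P : {poly 'F_p}) u x : (size P <= N)%N ->
  polyact P u x = \sum_(i < N) P`_i * u ((s ^+ i)%g x).
Proof.
move=> leN; rewrite ffunE (big_ord_widen _ (fun i => P`_i * u ((s ^+ i)%g x)) leN).
rewrite [RHS](bigID (fun i : 'I_N => (i < size P)%N)) /= [X in _ = _ + X]big1 ?addr0 //.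
by move=> i; rewrite -leqNgt => /leq_sizeP->; rewrite ?mul0r.
Qed.

Lemma polyactD P Q u : polyact (P + Q) u = polyact P u + polyact Q u.
Proof.
apply/ffunP=> x; rewrite [RHS]ffunE.
have le3 : (size (P + Q)%R <= maxn (size P) (size Q))%N by exact: size_polyD.
rewrite (polyactE _ _ le3) (polyactE _ _ (leq_maxl _ (size Q))).
rewrite (polyactE _ _ (leq_maxr (size P) _)).
by rewrite -big_split; apply: eq_bigr => i _; rewrite coefD mulrDl.
Qed.

Lemma polyact0 u : polyact 0 u = 0.
Proof. by apply/ffunP=> x; rewrite !ffunE size_poly0 big_ord0. Qed.

Lemma polyact_sum I (r : seq I) (P : I -> {poly 'F_p}) u :
  polyact (\sum_(i <- r) P i) u = \sum_(i <- r) polyact (P i) u.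
Proof. by elim/big_rec2: _ => [|i y x _ <-]; rewrite ?polyact0 ?polyactD. Qed.

Lemma polyactXn k u : polyact 'X^k u = act (s ^+ k)%g u.
Proof.
apply/ffunP=> x; rewrite !ffunE size_polyXn big_ord_recr /= coefXn eqxx mul1r.
rewrite big1 ?add0r // => i _.
by rewrite coefXn ltn_eqF // mul0r.
Qed.

Lemma polyactMX P u : polyact (P * 'X) u = act s (polyact P u).
Proof.
have leS : (size (P * 'X)%R <= (size P).+1)%N.
  by rewrite (leq_trans (size_polyMleq _ _)) // size_polyX addn2.
apply/ffunP=> x; rewrite (polyactE _ _ leS) !ffunE.
rewrite big_ord_recl coefMX eqxx mul0r add0r.
by apply: eq_bigr => i _; rewrite coefMX /= expgS permM.
Qed.

Lemma iter_diff_poly i u : iter i D u = polyact (('X - 1) ^+ i) u.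
Proof.
elim: i => [|i IH]; first by rewrite [RHS](polyactXn 0) act1.
rewrite iterS IH exprSr mulrBr mulr1 /diff -polyactMX.
by apply/eqP; rewrite subr_eq -polyactD subrK.
Qed.

Lemma subX1_expp e : ('X - 1 : {poly 'F_p}) ^+ (p ^ e) = 'X^(p ^ e) - 1.
Proof.
have pX : p \in [pchar {poly 'F_p}] by rewrite pchar_poly pchar_Fp.
rewrite exprDn_pchar ?exprNn_pchar ?expr1n //.
all: by rewrite pnatX (eq_pnat _ (pcharf_eq pX)) pnat_id.
Qed.

Lemma iter_diff_expp e u : iter (p ^ e) D u = diff (s ^+ (p ^ e))%g u.
Proof.
have polyact1 : polyact 1 u = u by rewrite [LHS](polyactXn 0) act1.
rewrite iter_diff_poly subX1_expp /diff -polyactXn -[X in _ = _ - X]polyact1.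
by apply/eqP; rewrite eq_sym subr_eq -polyactD subrK.
Qed.

(** Orbit sums under a power of [s] are iterated differences because
    [(X - 1)^(p^e - p^k)] is the geometric sum
    [(X^(p^e) - 1) / (X^(p^k) - 1)] in characteristic [p]. *)
Lemma iter_diff_orbit_sum e k u x : (k <= e)%N ->
  iter (p ^ e - p ^ k) D u x =
    \sum_(i < p ^ (e - k)) u ((s ^+ (p ^ k * i))%g x).
Proof.
move=> le_ke; rewrite iter_diff_poly.
have -> : ('X - 1 : {poly 'F_p}) ^+ (p ^ e - p ^ k) =
    \sum_(i < p ^ (e - k)) 'X^(p ^ k * i).
  have nz : ('X - 1 : {poly 'F_p}) ^+ (p ^ k) != 0.
    by rewrite expf_neq0 // monic_neq0 // -[1]/(1%:P) monicXsubC.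
  apply: (mulfI nz); rewrite -exprD subnKC ?leq_pexp2l ?prime_gt0 //.
  rewrite !subX1_expp -{1}(subnKC le_ke) expnD exprM subrX1.
  by congr (_ * _); apply: eq_bigr => i _; rewrite exprM.
rewrite polyact_sum sum_ffunE; apply: eq_bigr => i _.
by rewrite polyactXn ffunE.
Qed.

End Unipotent.

(** * Tableaux and the iterated wreath product *)

Section Tableaux.

Local Open Scope ring_scope.

Variables (p n : nat).
Local Notation vec := 'rV['F_p]_n.
Local Notation V := {ffun vec -> 'F_p}.
Implicit Types (x y z : vec) (u v w : V) (g h t : {perm vec}) (i j : 'I_n).

Definition coord i : V := [ffun x : vec => x ord0 i].
Local Notation X := coord.

Definition agree (k : nat) x y :=
  [forall i : 'I_n, (i < k)%N ==> (x ord0 i == y ord0 i)].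

Lemma agreeP k x y :
  reflect (forall i, (i < k)%N -> x ord0 i = y ord0 i) (agree k x y).
Proof.
apply: (iffP forallP) => [xy i ik | xy i]; last by apply/implyP=> /xy->.
by have /implyP/(_ ik)/eqP := xy i.
Qed.

Lemma agree_refl k x : agree k x x.
Proof. exact/agreeP. Qed.

Lemma agree_sym k x y : agree k x y = agree k y x.
Proof. by apply/agreeP/agreeP=> xy i /xy. Qed.

Lemma agree_trans k : transitive (agree k).
Proof. by move=> y x z /agreeP xy /agreeP yz; apply/agreeP=> i ik; rewrite xy ?yz. Qed.

Lemma agree_leq k l x y : (k <= l)%N -> agree l x y -> agree k x y.
Proof. by move=> kl /agreeP xy; apply/agreeP=> i ik; rewrite xy ?(leq_trans ik). Qed.

Lemma agree0 x y : agree 0 x y.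
Proof. exact/agreeP. Qed.

Lemma agree_full x y : agree n x y -> x = y.
Proof. by move/agreeP=> xy; apply/rowP=> i; apply: xy. Qed.

Lemma agreeS i x y : agree i.+1 x y = agree i x y && (x ord0 i == y ord0 i).
Proof.
apply/idP/andP=> [xy | [/agreeP xy /eqP xyi]].
  by split; [exact: agree_leq xy | apply/eqP; move/agreeP: xy; apply].
apply/agreeP=> j; rewrite ltnS leq_eqVlt => /predU1P[/val_inj-> // | /xy //].
Qed.

Lemma agree_prefix i x y : agree i x y = (Defs.prefix i x == Defs.prefix i y).
Proof.
apply/agreeP/eqP=> [xy | /rowP xy j ji].
  by apply/rowP=> j; rewrite !mxE xy //= ltn_ord.
have := xy (Ordinal ji); rewrite !mxE.
by rewrite (_ : widen_ord _ _ = j) //; apply: val_inj.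
Qed.

Definition depends (k : nat) : {set V} :=
  [set u : V | [forall x : vec, forall y : vec, agree k x y ==> (u x == u y)]].

Lemma dependsP k u : reflect (forall x y, agree k x y -> u x = u y) (u \in depends k).
Proof.
rewrite inE; apply: (iffP forallP) => [ud x y xy | ud x].
  by have /forallP/(_ y)/implyP/(_ xy)/eqP := ud x.
by apply/forallP=> y; apply/implyP=> /ud->.
Qed.

Lemma depends_leq k l u : (k <= l)%N -> u \in depends k -> u \in depends l.
Proof. by move=> kl /dependsP ud; apply/dependsP=> x y /(agree_leq kl)/ud. Qed.

Lemma depends0 k : 0 \in depends k.
Proof. by apply/dependsP=> x y _; rewrite !ffunE. Qed.

Lemma dependsD k u v : u \in depends k -> v \in depends k -> u + v \in depends k.
Proof.
move=> /dependsP ud /dependsP vd; apply/dependsP=> x y xy.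
by rewrite !ffunE (ud x y) ?(vd x y).
Qed.

Lemma dependsN k u : u \in depends k -> - u \in depends k.
Proof. by move=> /dependsP ud; apply/dependsP=> x y xy; rewrite !ffunE (ud x y). Qed.

Lemma dependsM k u v : u \in depends k -> v \in depends k -> u * v \in depends k.
Proof.
move=> /dependsP ud /dependsP vd; apply/dependsP=> x y xy.
by rewrite !ffunE (ud x y) ?(vd x y).
Qed.

Definition fibre (k : nat) x : V := [ffun y : vec => (agree k x y)%:R].

Lemma depends_fibre k x : fibre k x \in depends k.
Proof.
apply/dependsP=> y z yz; rewrite !ffunE; congr (_ %:R).
by congr nat_of_bool; apply/idP/idP=> /agree_trans; apply; rewrite // agree_sym.
Qed.

Lemma diffM g h u : diff (g * h)%g u = diff g u + act g (diff h u).
Proof. by apply/ffunP=> x; rewrite /diff actM !ffunE; ring. Qed.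

Lemma diff1 u : diff 1%g u = 0.
Proof. by rewrite /diff act1 subrr. Qed.

Lemma diffV g u : diff g^-1%g u = - act g^-1%g (diff g u).
Proof. by rewrite /diff actB actK opprB. Qed.

Lemma perm_coord g x i : (g x) ord0 i = x ord0 i + diff g (X i) x.
Proof. by rewrite /diff !ffunE; ring. Qed.

(** [diff g (coord i)] is, up to sign, the [i]-th entry of the tableau of [g]
    in the sense of Kaloujnine; a permutation lies in the iterated wreath
    product exactly when each entry depends on the previous coordinates only
    (see [iterW_triangular]). Describing the group by this closed condition,
    rather than by generators, makes membership a matter of computing
    differences of coordinates. *)
Definition triangular : {set {perm vec}} :=
  [set g : {perm vec} | [forall i : 'I_n, diff g (X i) \in depends i]].
Local Notation W := triangular.

Lemma triangularP g : reflect (forall i, diff g (X i) \in depends i) (g \in W).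
Proof. by rewrite inE; exact: forallP. Qed.

Lemma triangular_agree g k x y : g \in W -> agree k x y -> agree k (g x) (g y).
Proof.
move=> /triangularP Wg xy; apply/agreeP=> i ik; rewrite !perm_coord.
have /dependsP ud := Wg i; rewrite (ud x y); last exact: agree_leq (ltnW ik) xy.
by move/agreeP: xy => ->.
Qed.

Lemma depends_act g k u : g \in W -> u \in depends k -> act g u \in depends k.
Proof.
move=> Wg /dependsP ud; apply/dependsP=> x y xy; rewrite !ffunE.
by apply/ud/triangular_agree.
Qed.

Lemma triangular_group_set : group_set W.
Proof.
apply/group_setP; split=> [|g h Wg Wh]; apply/triangularP=> i.
  by rewrite diff1 depends0.
rewrite diffM dependsD ?depends_act //; exact/triangularP.
Qed.
Canonical triangular_group := Group triangular_group_set.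

Definition tail (k : nat) : {set {perm vec}} :=
  [set g in W | [forall x : vec, agree k (g x) x]].

Lemma tailP k g : reflect (g \in W /\ forall x, agree k (g x) x) (g \in tail k).
Proof.
by apply: (iffP setIdP) => [[Wg /forallP gx] | [Wg gx]]; split=> //; apply/forallP.
Qed.

Lemma tail_group_set k : group_set (tail k).
Proof.
apply/group_setP; split=> [|g h /tailP[Wg gx] /tailP[Wh hx]]; apply/tailP.
  by split=> [|x]; rewrite ?group1 // perm1 agree_refl.
split=> [|x]; first by rewrite groupM.
by rewrite permM; apply: agree_trans (hx _) (gx x).
Qed.
Canonical tail_group k := Group (tail_group_set k).

Lemma tail_sub k : tail k \subset W.
Proof. by apply/subsetP=> g /tailP[]. Qed.

Lemma tail_norm k : W \subset 'N(tail k).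
Proof.
apply/subsetP=> h Wh; rewrite inE; apply/subsetP=> _ /imsetP[g /tailP[Wg gx] ->].
apply/tailP; split=> [|x]; first by rewrite groupJ.
rewrite conjgE !permM -{2}[x](permKV h); apply: triangular_agree => //.
Qed.

Lemma tail_leq k l : (k <= l)%N -> tail l \subset tail k.
Proof.
move=> kl; apply/subsetP=> g /tailP[Wg gx]; apply/tailP; split=> // x.
exact: agree_leq (gx x).
Qed.

Lemma tail0 : tail 0 = W.
Proof.
apply/eqP; rewrite eqEsubset tail_sub; apply/subsetP=> g Wg; apply/tailP.
by split=> // x; apply: agree0.
Qed.

Lemma tail_full : tail n = 1%g.
Proof.
apply/trivgP/subsetP=> g /tailP[_ gx]; rewrite inE; apply/eqP/permP=> x.
by rewrite perm1; apply/agree_full.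
Qed.

Lemma tail_diff0 k g u : g \in tail k -> u \in depends k -> diff g u = 0.
Proof.
move=> /tailP[_ gx] /dependsP ud; apply/ffunP=> x.
by rewrite /diff !ffunE (ud _ _ (gx x)) subrr.
Qed.

Lemma tailS i g : (g \in tail i.+1) = (g \in tail i) && (diff g (X i) == 0).
Proof.
apply/tailP/andP=> [[Wg gx] | [/tailP[Wg gx] /eqP g0]].
  split; first by apply/tailP; split=> // x; apply: agree_leq (gx x).
  apply/eqP/ffunP=> x; have := gx x; rewrite agreeS => /andP[_ /eqP].
  rewrite perm_coord => e; apply: (addrI (x ord0 i)).
  by rewrite e [X in _ + X]ffunE addr0.
by split=> // x; rewrite agreeS gx perm_coord g0 ffunE addr0 eqxx.
Qed.

Lemma diffM_tail i t h : t \in tail i -> h \in W ->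
  diff (t * h)%g (X i) = diff t (X i) + diff h (X i).
Proof.
move=> Tt /triangularP/(_ i) hd; rewrite diffM; congr (_ + _).
by apply/eqP; rewrite -subr_eq0; apply/eqP/(tail_diff0 Tt).
Qed.

Lemma diffV_tail i t : t \in tail i -> diff t^-1%g (X i) = - diff t (X i).
Proof.
move=> Tt; have Wt := subsetP (tail_sub i) t Tt.
have := diffM_tail Tt (groupVr Wt); rewrite mulgV diff1 => /esym/eqP.
by rewrite addrC addr_eq0 => /eqP.
Qed.

(** The [i]-th entry identifies [tail i / tail i.+1] with the functions of the
    first [i] coordinates, and conjugation becomes translation. *)
Lemma diffJ_tail i t h : t \in tail i -> h \in W ->
  diff (t ^ h)%g (X i) = act h^-1%g (diff t (X i)).
Proof.
move=> Tt Wh; have Wt := subsetP (tail_sub i) t Tt.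
have Tth : (t ^ h)%g \in tail i by rewrite memJ_norm ?(subsetP (tail_norm i)).
have E : (t ^ h * h^-1 = h^-1 * t)%g by rewrite conjgE !mulgA mulgK.
have := diffM_tail Tth (groupVr Wh); rewrite E diffM addrC.
by move/addIr.
Qed.

(** Hence on that quotient taking a commutator is taking a difference. *)
Lemma diffR_tail i t h : t \in tail i -> h \in W ->
  diff [~ t, h] (X i) = diff h^-1%g (diff t (X i)).
Proof.
move=> Tt Wh; have Wt := subsetP (tail_sub i) t Tt.
rewrite commgEl diffM_tail ?groupV ?groupJ // diffV_tail // diffJ_tail //.
by rewrite addrC.
Qed.

Lemma Delta_coord i (f : {ffun 'rV['F_p]_i -> 'F_p}) j :
  diff (Delta f) (X j) = [ffun x => if j == i then - f (Defs.prefix i x) else 0].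
Proof.
apply/ffunP=> x; rewrite /diff !ffunE permE /Delta_fun !mxE eqxx /=.
by case: (j == i); rewrite ?mulr1 ?mulr0 ?subr0; ring.
Qed.

Lemma Delta_tail i (f : {ffun 'rV['F_p]_i -> 'F_p}) : Delta f \in tail i.
Proof.
apply/tailP; split=> [|x].
  apply/triangularP=> j; rewrite Delta_coord; apply/dependsP=> x y.
  by rewrite !ffunE; case: eqP => // -> ; rewrite agree_prefix => /eqP->.
apply/agreeP=> j ji; rewrite perm_coord Delta_coord ffunE -val_eqE ltn_eqF //.
by rewrite addr0.
Qed.

Lemma baseB_layer i u : u \in depends i ->
  exists2 b, b \in baseB p i :&: tail i & 
    forall j, diff b (X j) = if j == i then u else 0.
Proof.
move=> /dependsP ud; pose pad (a : 'rV['F_p]_i) : vec :=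
  \row_(j < n) (if insub (val j) is Some l then a ord0 l else 0).
have padK x : agree i (pad (Defs.prefix i x)) x.
  apply/agreeP=> j ji; rewrite mxE insubT mxE; congr (x _ _); exact: val_inj.
exists (Delta [ffun a => - u (pad a)]) => [|j].
  by rewrite inE Delta_tail andbT; apply/imsetP; exists [ffun a => - u (pad a)].
rewrite Delta_coord; apply/ffunP=> x; rewrite !ffunE.
by case: (j == i); rewrite ?ffunE // opprK; apply/ud.
Qed.

Lemma tail_baseB i : (baseB p i * tail i.+1)%g = tail i.
Proof.
apply/eqP; rewrite eqEsubset; apply/andP; split.
  apply/subsetP=> _ /mulsgP[_ t /imsetP[f _ ->] Tt ->].
  by rewrite groupM ?Delta_tail // (subsetP (tail_leq (leqnSn i))).
apply/subsetP=> g Tg.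
have /baseB_layer[b /setIP[Bb Tb] bX] : diff g (X i) \in depends i.
  by apply/triangularP; case/tailP: Tg.
rewrite -(mulKVg b g) mem_mulg // tailS groupM ?groupV //=.
rewrite diffM_tail ?groupV ?diffV_tail //; last by case/tailP: Tg.
by rewrite bX eqxx addNr.
Qed.

Lemma tailB_tail k : (k <= n)%N -> tailB p n k.+1 = tail k.
Proof.
pose F m : {set {perm vec}} := if insub m is Some i then baseB p (i : 'I_n) else 1%g.
have -> : tailB p n k.+1 = (\prod_(k <= m < n) F m)%g.
  rewrite big_geq_mkord; apply: eq_bigr => i _; rewrite /F insubT //= => lt_in.
  by rewrite (_ : Sub _ _ = i) //; apply: val_inj.
move=> /subnKC; move: (n - k)%N => d; elim: d k => [|d IH] l.
  by rewrite addn0 => El; rewrite big_geq ?El // tail_full.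
move=> El; have lt_ln : (l < n)%N by lia.
rewrite big_ltn // IH; last by lia.
by rewrite /F insubT (tail_baseB (Ordinal lt_ln)).
Qed.

Lemma iterW_triangular : iterW p n :=: W.
Proof.
apply/eqP; rewrite eqEsubset; apply/andP; split.
  rewrite gen_subG; apply/bigcupsP=> i _; apply/subsetP=> _ /imsetP[f _ ->].
  by case/tailP: (Delta_tail f).
rewrite -tail0 -tailB_tail //; apply/subsetP=> _ /prodsgP[c cB ->].
by apply: group_prod => i le_i; apply/mem_gen/bigcupP; exists i => //; apply: cB.
Qed.

Lemma triangular_pgroup : prime p -> p.-group W.
Proof.
move=> p_pr.
have powX i t k : t \in tail i -> diff (t ^+ k)%g (X i) = diff t (X i) *+ k.
  move=> Tt; elim: k => [|k IH]; first by rewrite expg0 diff1.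
  by rewrite expgS diffM_tail ?IH ?mulrS // (subsetP (tail_sub i)) ?groupX.
have pow k g : (k <= n)%N -> g \in W -> (g ^+ (p ^ k))%g \in tail k.
  elim: k => [|k IH] kn Wg; first by rewrite tail0.
  have Tk := IH (ltnW kn) Wg.
  rewrite expnSr expgM (tailS (Ordinal kn)) groupX //=.
  rewrite powX //; apply/eqP/ffunP=> x.
  by rewrite ffunMnE -mulr_natr pchar_Fp_0 // mulr0 ffunE.
rewrite -pnat_exponent; apply: (@pnat_dvd _ (p ^ n)); last by rewrite pnatX pnat_id.
apply/exponentP=> g Wg; apply/set1gP; rewrite -tail_full; exact: pow.
Qed.

End Tableaux.

(** * The odometer *)

Section Odometer.

Local Open Scope ring_scope.

Variables (p n : nat).
Hypothesis p_pr : prime p.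
Local Notation vec := 'rV['F_p]_n.
Local Notation X := (@coord p n).
Local Notation W := (triangular p n).
Implicit Types (x y z : vec) (i j : 'I_n).

Lemma triangular_exists (F : 'I_n -> {ffun vec -> 'F_p}) :
  (forall i, F i \in depends p n i) ->
  exists2 g, g \in W & forall i, diff g (X i) = F i.
Proof.
move=> Fd.
have partial k : (k <= n)%N ->
    exists2 g, g \in W & forall i, (i < k)%N -> diff g (X i) = F i.
  elim: k => [|k IH] lt_kn.
    by exists 1%g; rewrite ?group1.
  have [g Wg gF] := IH (ltnW lt_kn); pose k' := Ordinal lt_kn.
  have /baseB_layer[t /setIP[_ Tt] tX] : F k' - diff g (X k') \in depends p n k'.
    by rewrite dependsD ?dependsN //; apply/triangularP.
  have Wt := subsetP (tail_sub p n k') t Tt.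
  exists (t * g)%g => [|i]; first by rewrite groupM.
  rewrite ltnS => le_ik.
  rewrite diffM_tail ?tX //; last first.
    by apply: (subsetP (tail_leq p n le_ik)).
  case: eqP => [->|/eqP ne_ik]; first by rewrite subrK.
  by rewrite add0r gF // ltn_neqAle le_ik andbT.
by have [g Wg gF] := partial n (leqnn n); exists g => // i; apply: gF.
Qed.

(** An adding machine: coordinate [i] is incremented exactly when all the
    previous ones vanish, so that the [p ^ n] vectors form one cycle. *)
Lemma odometer_exists :
  exists2 s, s \in W & forall i, diff s (X i) = fibre i (0 : vec).
Proof. by apply: triangular_exists => i; apply: depends_fibre. Qed.

Variable s : {perm vec}.
Hypothesis sX : forall i, diff s (X i) = fibre i (0 : vec).

Lemma odometer_coord m x i :
  ((s ^+ m)%g x) ord0 i =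
    x ord0 i + \sum_(l < m) fibre i (0 : vec) ((s ^+ l)%g x).
Proof.
elim: m => [|m IH]; first by rewrite perm1 big_ord0 addr0.
by rewrite expgSr permM perm_coord sX IH big_ord_recr addrA.
Qed.

Let period k := forall x m, agree k ((s ^+ m)%g x) x = (p ^ k %| m)%N.
Let level_transitive k := forall x y, exists m, agree k ((s ^+ m)%g x) y.

Lemma odometer_agree k x m l : period k ->
  agree k ((s ^+ m)%g x) ((s ^+ l)%g x) = (m == l %[mod p ^ k]).
Proof.
move=> per; wlog le_lm : m l / (l <= m)%N.
  by move=> IH; case/orP: (leq_total l m) => /IH // e; rewrite agree_sym e eq_sym.
by rewrite -{1}(subnKC le_lm) expgD permM per eqn_mod_dvd.
Qed.

(** During [p ^ i] steps the first [i] coordinates take each value once, so a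
    single carry reaches coordinate [i]. *)
Lemma odometer_carry i x : period i -> level_transitive i ->
  ((s ^+ (p ^ i))%g x) ord0 i = x ord0 i + 1.
Proof.
move=> per tr; rewrite odometer_coord; congr (_ + _).
have [m xm] := tr x 0.
have pi_gt0 : (0 < p ^ i)%N by rewrite expn_gt0 prime_gt0.
have term l : fibre i (0 : vec) ((s ^+ l)%g x) = (l == m %[mod p ^ i])%:R.
  rewrite ffunE -(odometer_agree x l m per); congr (nat_of_bool _)%:R.
  apply/idP/idP=> [lx | lx]; first by rewrite agree_sym (agree_trans xm).
  by rewrite agree_sym (agree_trans lx).
rewrite (bigD1 (Ordinal (ltn_pmod m pi_gt0))) //= term modn_mod eqxx.
rewrite big1 ?addr0 // => l ne_lm; rewrite term modn_small //.
by rewrite -val_eqE /= in ne_lm; rewrite (negbTE ne_lm).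
Qed.

Lemma odometer_carryMn i x b : period i -> level_transitive i ->
  ((s ^+ (p ^ i * b))%g x) ord0 i = x ord0 i + b%:R.
Proof.
move=> per tr; elim: b => [|b IH]; first by rewrite muln0 perm1 addr0.
by rewrite mulnS addnC expgD permM odometer_carry // IH -addrA -natr1.
Qed.

Lemma odometer_period_transitive k : (k <= n)%N -> period k /\ level_transitive k.
Proof.
elim: k => [|k IH] lt_kn.
  by split=> [x m|x y]; [rewrite agree0 dvd1n | exists 0%N; rewrite agree0].
have [per tr] := IH (ltnW lt_kn); pose i := Ordinal lt_kn.
split=> [x m|x y].
  rewrite (agreeS i) /= per; apply/andP/idP=> [[/dvdnP[b ->]] | dm].
    rewrite mulnC (@odometer_carryMn i) // -subr_eq0 addrAC subrr add0r.
    by rewrite -(dvdn_pcharf (pchar_Fp p_pr)) expnSr dvdn_pmul2l // expn_gt0 prime_gt0.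
  split; first by apply: dvdn_trans dm; rewrite expnSr dvdn_mulr.
  case/dvdnP: dm => b ->; rewrite mulnC expnSr -mulnA (@odometer_carryMn i) //.
  by rewrite natrM pchar_Fp_0 // mul0r addr0.
have [m xm] := tr x y.
pose b := nat_of_ord (y ord0 i - ((s ^+ m)%g x) ord0 i).
exists (m + p ^ k * b)%N; rewrite expgD permM (agreeS i) /=; apply/andP; split.
  by apply: agree_trans xm; rewrite per dvdn_mulr.
by rewrite (@odometer_carryMn i) // /b natr_Zp addrC subrK.
Qed.

End Odometer.

(** * Normal subgroups and the lower central series *)

Section LowerCentral.

Local Open Scope ring_scope.

Variables (p n' : nat).
Hypothesis p_pr : prime p.
Local Notation n := n'.+1.
Local Notation vec := 'rV['F_p]_n.
Local Notation V := {ffun vec -> 'F_p}.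
Local Notation X := (@coord p n).
Local Notation W := (triangular p n).
Local Notation tail := (tail p n).
Local Notation depends := (depends p n).
Local Notation top := (ord_max : 'I_n).
Implicit Types (x y z : vec) (u v w : V) (g h t : {perm vec}) (i j : 'I_n).
Implicit Types H N : {group {perm vec}}.

Let pX_gt0 k : (0 < p ^ k)%N.
Proof. by rewrite expn_gt0 prime_gt0. Qed.

(** The image of [H :&: tail i] in [tail i / tail i.+1], written as a set of
    functions. For normal [H] it is stable under differences, so by
    uniseriality it is determined by its largest degree. *)
Definition layer i (H : {set {perm vec}}) : {set V} :=
  [set diff t (X i) | t in H :&: tail i].

Lemma layerP i (H : {set {perm vec}}) u :
  reflect (exists t, [/\ t \in H, t \in tail i & diff t (X i) = u])
          (u \in layer i H).
Proof.
apply: (iffP imsetP) => [[t /setIP[Ht Tt] ->] | [t [Ht Tt <-]]].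
  by exists t.
by exists t => //; apply/setIP.
Qed.

Lemma layerB i H u v : u \in layer i H -> v \in layer i H -> u - v \in layer i H.
Proof.
move=> /layerP[t [Ht Tt <-]] /layerP[t' [Ht' Tt' <-]]; apply/layerP.
have Wt' := subsetP (tail_sub p n i) _ Tt'.
exists (t * t'^-1)%g; rewrite !groupM ?groupV //; split=> //.
by rewrite diffM_tail ?groupV // diffV_tail.
Qed.

Lemma layer_diff i H g u : W \subset 'N(H) -> g \in W ->
  u \in layer i H -> diff g u \in layer i H.
Proof.
move=> nHW Wg /layerP[t [Ht Tt <-]]; apply/layerP.
exists [~ t, g^-1]%g; split.
- by rewrite commgEl groupM ?groupV // memJ_norm // groupV (subsetP nHW).
- rewrite commgEl groupM ?groupV // memJ_norm // groupV.
  exact: (subsetP (tail_norm p n i)).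
by rewrite diffR_tail ?groupV // invgK.
Qed.

Lemma layer_depends i H u : H \subset W -> u \in layer i H -> u \in depends i.
Proof.
move=> sHW /layerP[t [Ht _ <-]].
by apply: (triangularP _ _); apply: (subsetP sHW).
Qed.

Lemma card_layer i H : H \subset W ->
  #|H :&: tail i| = (#|layer i H| * #|H :&: tail i.+1|)%N.
Proof.
move=> sHW; rewrite -sum1_card (partition_big_imset (fun t => diff t (X i))) /=.
rewrite -/(layer i H) -sum_nat_const; apply: eq_bigr => v /layerP[t0 [H0 T0 <-]].
rewrite -(card_lcoset (H :&: tail i.+1) t0) -sum1_card; apply: eq_bigl => t.
have W0 := subsetP sHW _ H0; have [H0V T0V] := (groupVr H0, groupVr T0).
rewrite mem_lcoset !in_setI tailS (groupMl _ H0V) (groupMl _ T0V).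
case: (boolP (t \in H)) => //= Ht; case: (boolP (t \in tail i)) => //= Tt.
rewrite diffM_tail ?groupV ?diffV_tail //; last exact: (subsetP sHW).
by rewrite addrC subr_eq0.
Qed.

Variable s : {perm vec}.
Hypothesis Ws : s \in W.
Hypothesis sX : forall i, diff s (X i) = fibre i (0 : vec).
Local Notation L := (stratum p s).

Let period k x m : (k <= n)%N -> agree k ((s ^+ m)%g x) x = (p ^ k %| m)%N.
Proof. by case/(odometer_period_transitive p_pr sX) => per _; apply: per. Qed.

Let s_trans x y : exists m, (s ^+ m)%g x = y.
Proof.
have [_ tr] := odometer_period_transitive p_pr sX (leqnn n).
by have [m /agree_full] := tr x y; exists m.
Qed.

(** In characteristic [p], the [p ^ k]-fold difference vanishes exactly on the
    functions invariant under [s ^+ (p ^ k)], and the cycles of that power of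
    the odometer are the fibres of the first [k] coordinates. *)
Lemma depends_stratum k : (k <= n)%N -> depends k = L (p ^ k).
Proof.
move=> le_kn; apply/setP=> u; apply/idP/idP=> [du | /stratumP].
  apply/stratumP; rewrite iter_diff_expp //; apply: (@tail_diff0 p n k) => //.
  by apply/tailP; split=> [|x]; rewrite ?groupX ?period.
rewrite iter_diff_expp // => /eqP; rewrite subr_eq0 => /eqP su.
apply/dependsP=> x y xy; have [m Em] := s_trans y x.
move: xy; rewrite -Em period // => /dvdnP[b ->].
elim: b => [|b IH]; first by rewrite perm1.
by rewrite mulSnr expgD permM -[RHS]IH -[in RHS]su ffunE.
Qed.

(** The coordinate [x_i] has weight [p ^ i]. This single fact turns estimates
    on functions into estimates on tableau entries. *)
Lemma coord_stratum i : X i \in L (p ^ i).+1.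
Proof.
have [per tr] := odometer_period_transitive p_pr sX (ltnW (ltn_ord i)).
have sX1 : diff (s ^+ (p ^ i))%g (X i) = 1.
  apply/ffunP=> x; apply: (addrI (x ord0 i)); rewrite -perm_coord.
  by rewrite (odometer_carry p_pr sX x per tr) ffunE.
apply/stratumP; rewrite iterS iter_diff_expp // sX1.
by apply/ffunP=> x; rewrite /diff !ffunE subrr.
Qed.

Lemma coord_depends i : X i \in depends i.+1.
Proof. by apply/dependsP=> x y /agreeP xy; rewrite !ffunE xy. Qed.

Lemma layer_stratum i H a v : H \subset W -> W \subset 'N(H) ->
  v \in layer i H -> v \notin L a -> L a.+1 \subset layer i H.
Proof.
move=> sHW nHW Hv va; apply/subsetP=> u; move: u.
pose S u : Prop := u \in layer i H.
apply: (@stratum_sub_diff_stable _ _ s s_trans S a v (p ^ i)%N) => //.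
- exact: layerB.
- by move=> u; apply: layer_diff.
by rewrite -depends_stratum ?(layer_depends sHW) // ltnW.
Qed.

(** The induction step of [stratum_lower]. The functions of degree at most [a]
    on the last level form a nontrivial normal subgroup [P] of the [p]-group
    [W]. Nilpotency makes [[P, W]] proper in [P], and by uniseriality a proper
    submodule consists of functions of degree less than [a]. *)
Lemma stratum_stable_lower a : (a.+1 <= p ^ n')%N ->
  (forall g u, g \in W -> u \in L a.+1 -> act g u \in L a.+1) ->
  forall g u, g \in W -> u \in L a.+1 -> diff g u \in L a.
Proof.
move=> le_aQ stable g u Wg ua.
have depL v : v \in L a.+1 -> v \in depends top.
  by rewrite depends_stratum // => /(stratum_leq le_aQ).
pose P := [set t in tail top | diff t (X top) \in L a.+1].
have PP t : reflect (t \in tail top /\ diff t (X top) \in L a.+1) (t \in P).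
  exact: setIdP.
have tailW t : t \in tail top -> t \in W by apply: (subsetP (tail_sub p n _)).
have gP : group_set P.
  apply/group_setP; split=> [|t t' /PP[Tt tL] /PP[Tt' tL']]; apply/PP.
    by rewrite group1 diff1 stratum_zero.
  rewrite groupM //; split=> //; rewrite (diffM_tail Tt (tailW _ Tt')).
  exact: stratumD.
pose PG := Group gP.
have sPW : PG \subset W by apply/subsetP=> t /PP[/tailW].
have nPW : W \subset 'N(PG).
  apply/subsetP=> h Wh; rewrite inE; apply/subsetP=> _ /imsetP[t /PP[Tt tL] ->].
  apply/PP; rewrite memJ_norm ?(subsetP (tail_norm p n _)) //; split=> //.
  by rewrite diffJ_tail // stable ?groupV.
have lift v : v \in L a.+1 -> exists2 t, t \in P & diff t (X top) = v.
  move=> va; have [t /setIP[_ Tt] tX] := baseB_layer (depL v va).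
  by exists t; rewrite ?tX ?eqxx //; apply/PP; rewrite tX eqxx.
have P1 : PG :!=: 1%g.
  have /lift[t Pt tX] : fibre 0 (0 : vec) \in L a.+1.
    apply: (@stratum_leq _ _ _ (p ^ 0)%N) => //.
    by rewrite -depends_stratum ?depends_fibre.
  apply/trivgPn; exists t => //; apply: contra_eq_neq tX => ->.
  rewrite diff1; apply/eqP=> /ffunP/(_ 0); rewrite !ffunE agree0 => /eqP.
  by rewrite eq_sym oner_eq0.
have nilW : nilpotent W := pgroup_nil (triangular_pgroup n p_pr).
have /properP[_ [t0 Pt0 t0P]] : [~: PG, W] \proper PG.
  by apply: (nil_comm_properl nilW) => //; rewrite subsetI subxx.
apply: contraR t0P => nL.
have [t Pt tX] := lift u ua.
have [Tt _] := PP _ Pt.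
have sRP : [~: PG, W] \subset PG by rewrite commg_subl.
have : L a.+1 \subset layer top [~: PG, W].
  apply: layer_stratum nL; [exact: subset_trans sRP sPW | exact: commg_normr |].
  apply/layerP; exists [~ t, g^-1]%g; split.
  - by rewrite mem_commg ?groupV.
  - have /(subsetP sRP)/PP[//] : [~ t, g^-1]%g \in [~: PG, W].
    by rewrite mem_commg ?groupV.
  by rewrite diffR_tail ?groupV // invgK tX.
have [Tt0 t0L] := PP _ Pt0.
move=> /subsetP/(_ _ t0L)/layerP[c [Rc Tc cX]].
suff : (c^-1 * t0)%g \in tail top.+1.
  by rewrite (tail_full p n) inE -eq_mulVg1 => /eqP<-.
rewrite tailS groupM ?groupV //=.
by rewrite diffM_tail ?groupV ?tailW // diffV_tail // cX addNr.
Qed.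

(** Every element of [W], not only the odometer, lowers degrees. The bound
    [(p ^ n').+1] is what the coordinates need, by [coord_stratum]: the
    functions beyond [p ^ n'] are handled by subtracting a multiple of the last
    coordinate. *)
Lemma stratum_lower a g u : (a <= (p ^ n').+1)%N -> g \in W -> u \in L a ->
  diff g u \in L a.-1.
Proof.
(* Stability goes down from the functions of the first [n'] coordinates, which
   are stable by triangularity. *)
have stable d : (d <= p ^ n')%N -> forall h v, h \in W ->
    v \in L (p ^ n' - d) -> act h v \in L (p ^ n' - d).
  elim: d => [|d IH] le_d h v Wh.
    by rewrite subn0 -depends_stratum //; apply: depends_act.
  have Ed : (p ^ n' - d = (p ^ n' - d.+1).+1)%N by lia.
  move=> vL; rewrite -[act h v](subrK v) stratumD //.
  apply: stratum_stable_lower => //; first by lia.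
    by rewrite -Ed; apply: IH; apply: ltnW.
  by apply: stratum_leq vL.
have lower b h v : (b <= p ^ n')%N -> h \in W -> v \in L b -> diff h v \in L b.-1.
  case: b => [|b] le_b Wh vb.
    by move: vb; rewrite stratum0 => /eqP->; rewrite diff0 stratum_zero.
  apply: (stratum_stable_lower le_b) => // h' v'.
  by have := stable (p ^ n' - b.+1)%N; rewrite subKn //; apply; rewrite leq_subr.
rewrite leq_eqVlt => /predU1P[->|le_a] Wg; last exact: lower.
move=> uL /=; have XL := coord_stratum top.
have X1 : iter (p ^ n') (diff s) (X top) = 1.
  have [per tr] := odometer_period_transitive p_pr sX (leqnSn n').
  rewrite iter_diff_expp //; apply/ffunP=> x; apply: (addrI (x ord0 top)).
  by rewrite -perm_coord (@odometer_carry _ _ p_pr _ sX top) // ffunE.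
pose k := nat_of_ord (iter (p ^ n') (diff s) u 0).
have vL : u - X top *+ k \in L (p ^ n').
  apply/stratumP/ffunP=> x; rewrite iter_diffB iter_diffMn X1.
  have := iter_diff_const s_trans x 0 uL; rewrite /k.
  move: (iter _ _ u) => u' ux.
  by rewrite 2!ffunE ffunMnE [(1 : V) x]ffunE natr_Zp [RHS]ffunE ux subrr.
have XMn : diff g (X top *+ k) \in L (p ^ n').
  rewrite -depends_stratum //; move: k {vL} => k; elim: k => [|k IH].
    by rewrite mulr0n diff0 depends0.
  by rewrite mulrS diffD dependsD //; apply: (triangularP _ _).
rewrite -[u](subrK (X top *+ k)) diffD stratumD //.
by apply: stratum_leq (lower _ _ _ _ Wg vL); rewrite ?leq_pred.
Qed.

Lemma stratum_act a g u : (a <= (p ^ n').+1)%N -> g \in W -> u \in L a ->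
  act g u \in L a.
Proof.
move=> le_a Wg uL; rewrite -[act g u](subrK u) stratumD //.
exact: stratum_leq (leq_pred a) (stratum_lower le_a Wg uL).
Qed.

Definition lowering (c : nat) : {set {perm vec}} :=
  [set g in W | [forall a : 'I_(p ^ n').+2, forall u in L a, diff g u \in L (a - c)]].

Lemma loweringP c g :
  reflect (g \in W /\
    forall a u, (a <= (p ^ n').+1)%N -> u \in L a -> diff g u \in L (a - c))
    (g \in lowering c).
Proof.
apply: (iffP setIdP) => -[Wg lg]; split=> //.
  move=> a u le_a; move: u; apply/forall_inP.
  by move/forallP: lg => /(_ (Ordinal (le_a : a < (p ^ n').+2)%N)).
by apply/forallP=> a; apply/forall_inP=> u uL; apply: lg => //; rewrite -ltnS.
Qed.

Lemma lowering_group_set c : group_set (lowering c).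
Proof.
apply/group_setP; split=> [|g h /loweringP[Wg lg] /loweringP[Wh lh]].
  by apply/loweringP; split=> // a u _ _; rewrite diff1 stratum_zero.
apply/loweringP; rewrite groupM //; split=> // a u le_a uL.
rewrite diffM stratumD ?lg // stratum_act ?lh //.
exact: leq_trans (leq_subr _ _) le_a.
Qed.
Canonical lowering_group c := Group (lowering_group_set c).

(** By [diff_commg], if [g] lowers degrees by [c] and [h] by one, then their
    commutator lowers degrees by [c.+1]. *)
Lemma lcn_lowering c : 'L_c.+1(W) \subset lowering c.+1.
Proof.
elim: c => [|c IH].
  rewrite lcn1; apply/subsetP=> g Wg; apply/loweringP; split=> // a u le_a uL.
  by rewrite subn1 stratum_lower.
rewrite lcnSn gen_subG; apply/subsetP=> _ /imset2P[g h /(subsetP IH) lg Wh ->].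
have /loweringP[Wg {}lg] := lg; apply/loweringP.
rewrite groupR //; split=> // a u le_a uL.
have le_sub b : (a - b <= (p ^ n').+1)%N := leq_trans (leq_subr b a) le_a.
rewrite diff_commg stratum_act ?groupM ?groupV // stratumB //.
  have -> : (a - c.+2 = a.-1 - c.+1)%N by lia.
  by apply: lg; rewrite ?stratum_lower // -subn1.
have -> : (a - c.+2 = (a - c.+1).-1)%N by lia.
by rewrite stratum_lower // lg.
Qed.

Lemma sum_ord_dvdn m r (F : nat -> 'F_p) : (0 < m)%N ->
  \sum_(i < m * r) (m %| i)%:R * F i = \sum_(i < r) F (m * i)%N.
Proof.
move=> m_gt0; elim: r => [|r IH]; first by rewrite muln0 !big_ord0.
rewrite mulnS addnC big_split_ord /= IH big_ord_recr; congr (_ + _).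
rewrite (bigD1 (Ordinal m_gt0)) //= addn0 dvdn_mulr // mul1r big1 ?addr0 // => i ne_i0.
rewrite dvdn_addr ?dvdn_mulr // gtnNdvd ?mul0r // lt0n.
by rewrite -val_eqE in ne_i0.
Qed.

(** For functions of the first [e] coordinates, having degree less than
    [p ^ e - p ^ k] means that the sum over each fibre of the first [k]
    coordinates vanishes, and a fibre sum is the total sum after
    multiplication by the indicator of the fibre. *)
Lemma iter_diff_fibre k e u x : (k <= e <= n)%N ->
  iter (p ^ e - 1) (diff s) (fibre k x * u) x = iter (p ^ e - p ^ k) (diff s) u x.
Proof.
case/andP=> le_ke le_en.
rewrite -[X in (_ - X)%N](expn0 p) !iter_diff_orbit_sum // subn0.
have -> : (p ^ e = p ^ k * p ^ (e - k))%N by rewrite -expnD subnKC.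
rewrite -(sum_ord_dvdn _ (fun i : nat => u ((s ^+ i)%g x))) //.
apply: eq_bigr => i _; rewrite expn0 mul1n !ffunE agree_sym period //.
exact: leq_trans le_en.
Qed.

(** Elements of [tail k] preserve the fibres of the first [k] coordinates and
    commute with multiplication by their indicators; so they change no fibre
    sum, as elements of [W] change no total sum. *)
Lemma tail_lower k e g u : (e <= n')%N -> g \in tail k -> u \in L (p ^ e) ->
  diff g u \in L (p ^ e - p ^ k).
Proof.
move=> le_en Tg; rewrite -depends_stratum ?leqW // => ud.
have Wg := subsetP (tail_sub p n k) _ Tg.
have [le_ke|lt_ek] := leqP k e; last first.
  by rewrite (tail_diff0 Tg) ?stratum_zero //; apply: depends_leq ud; apply: ltnW.
apply/stratumP/ffunP=> x; rewrite -iter_diff_fibre ?le_ke ?leqW //.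
have -> : fibre k x * diff g u = diff g (fibre k x * u).
  have /eqP := tail_diff0 Tg (depends_fibre k x); rewrite subr_eq0 => /eqP gx.
  by rewrite /diff actMr gx mulrBr.
have := @stratum_lower (p ^ e) g (fibre k x * u).
rewrite -subn1 => /(_ _ Wg _)/stratumP-> //.
  by rewrite (leq_trans (leq_pexp2l _ le_en)) ?prime_gt0.
rewrite -depends_stratum ?leqW // dependsM // (depends_leq le_ke) //.
exact: depends_fibre.
Qed.

(** The bound of [tail_lower] is attained as soon as the [i]-th entry of [g] is
    nonzero. The argument is a duality: if all differences [diff g u] had
    smaller degree, their products with the coordinate [x_i], of weight
    [p ^ i], would have vanishing total sum. Then so would the products of
    every [u] with [diff g^-1 x_i]; taking for [u] the indicators of the
    fibres of the first [j] coordinates shows that [g] fixes [x_i]. *)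
Lemma tail_not_lower i j g : (i < j)%N -> g \in tail i -> g \notin tail i.+1 ->
  exists2 u, u \in L (p ^ j) & diff g u \notin L (p ^ j - p ^ i).-1.
Proof.
move=> lt_ij Tg nTg; have Wg := subsetP (tail_sub p n i) _ Tg.
have le_jn : (j <= n')%N by rewrite -ltnS.
have le_jn1 : (j <= n)%N := leqW le_jn.
apply/exists_inP; apply: contraR nTg; rewrite negb_exists_in => /forall_inP low.
have {}low u : u \in L (p ^ j) -> diff g u \in L (p ^ j - p ^ i).-1.
  by move=> /low/negPn.
rewrite tailS Tg /=.
suff g'X : diff g^-1%g (X i) = 0.
  by rewrite -[g]invgK diffV g'X act0 oppr0.
apply/ffunP=> x; have uL : fibre j x \in L (p ^ j).
  by rewrite -depends_stratum ?depends_fibre.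
have -> : diff g^-1%g (X i) x = iter (p ^ j - p ^ j) (diff s) (diff g^-1%g (X i)) x.
  by rewrite subnn.
rewrite -iter_diff_fibre ?leqnn //; set u := fibre j x in uL *.
have -> : u * diff g^-1%g (X i) =
    diff g u * X i - diff g (u * act g^-1%g (X i)).
  rewrite [diff g (_ * _)]/diff actMr actKV /diff.
  by apply/ffunP=> y; rewrite !ffunE; ring.
suff vL : diff g u * X i - diff g (u * act g^-1%g (X i)) \in L (p ^ j - 1).
  by move/stratumP: vL => ->.
have le_p : (p ^ j <= (p ^ n').+1)%N by rewrite leqW ?leq_pexp2l ?prime_gt0.
rewrite stratumB //; last first.
  rewrite subn1 stratum_lower // -depends_stratum // dependsM //.
    by rewrite depends_stratum.
  apply: (depends_leq lt_ij); rewrite depends_act ?groupV //; exact: coord_depends.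
have := low u uL; case E: (p ^ j - p ^ i).-1 => [|c].
  by rewrite stratum0 => /eqP->; rewrite mul0r stratum_zero.
move=> /stratum_mul/(_ (coord_stratum i)).
apply: stratum_leq => //.
by move: (pX_gt0 i); lia.
Qed.

(** The term [p ^ k + 1] of the lower central series (see [lcn_eq_core]),
    described by weights of tableau entries. The truncated subtraction makes the
    entries of level at most [k] vanish. *)
Definition core (k : nat) : {set {perm vec}} :=
  [set g in W | [forall i, diff g (X i) \in L (p ^ i - p ^ k)]].

Lemma coreP k g :
  reflect (g \in W /\ forall i, diff g (X i) \in L (p ^ i - p ^ k)) (g \in core k).
Proof.
by apply: (iffP setIdP) => [[Wg /forallP lg] | [Wg lg]]; split=> //; apply/forallP.
Qed.

Let le_core i c : (p ^ i - c <= (p ^ n').+1)%N.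
Proof.
by rewrite (leq_trans (leq_subr _ _)) // leqW // leq_pexp2l ?prime_gt0 // -ltnS.
Qed.

Lemma core_group_set k : group_set (core k).
Proof.
apply/group_setP; split=> [|g h /coreP[Wg lg] /coreP[Wh lh]]; apply/coreP.
  by split=> // i; rewrite diff1 stratum_zero.
by rewrite groupM //; split=> // i; rewrite diffM stratumD // stratum_act ?le_core.
Qed.
Canonical core_group k := Group (core_group_set k).

Lemma core_sub k : core k \subset W.
Proof. by apply/subsetP=> g /coreP[]. Qed.

Lemma core_sub_tail i : core i \subset tail i.+1.
Proof.
apply/subsetP=> g /coreP[Wg lg].
have le_in : (i.+1 <= n)%N by [].
elim: {-2}(i.+1) (leqnn i.+1) => [|l IH] le_li; first by rewrite tail0.
have lt_ln : (l < n)%N := leq_trans le_li le_in.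
rewrite (tailS (Ordinal lt_ln)) IH ?(ltnW le_li) //=.
have := lg (Ordinal lt_ln); rewrite -(stratum0 s) /=.
by have -> : (p ^ l - p ^ i = 0)%N by apply/eqP; rewrite subn_eq0 leq_pexp2l ?prime_gt0.
Qed.

Lemma lcn_core k : 'L_(p ^ k).+1(W) \subset core k.
Proof.
apply/subsetP=> g /(subsetP (lcn_lowering _))/loweringP[Wg lg]; apply/coreP.
split=> // i; rewrite -subSS; apply: lg (coord_stratum i).
by rewrite ltnS leq_pexp2l ?prime_gt0 // -ltnS.
Qed.

Lemma tail_commg_core k : [~: tail k, tail k] \subset core k.
Proof.
rewrite gen_subG; apply/subsetP=> _ /imset2P[g h Tg Th ->].
have [Wg Wh] : g \in W /\ h \in W by split; apply: (subsetP (tail_sub p n k)).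
apply/coreP; rewrite groupR //; split=> // i.
have dL f : f \in W -> diff f (X i) \in L (p ^ i).
  by rewrite -depends_stratum ?(ltnW (ltn_ord i)) // => Wf; apply/triangularP.
have le_in : (i <= n')%N by rewrite -ltnS.
rewrite diff_commg stratum_act ?le_core ?groupM ?groupV //.
by rewrite stratumB // tail_lower ?dL.
Qed.

(** [[N, tail i.+1]] lies in the core, and by [tail_not_lower] and uniseriality
    its layers are as large as those of the core; hence both are equal. *)
Lemma core_sub_commg i N : W \subset 'N(N) -> N \subset tail i ->
  ~~ (N \subset tail i.+1) -> core i \subset [~: N, tail i.+1].
Proof.
move=> nNW sNT /subsetPn[g Ng nTg]; set M := [~: N, tail i.+1].
have sT : tail i.+1 \subset tail i := tail_leq p n (leqnSn i).
have sMcore : M \subset core i := subset_trans (commgSS sNT sT) (tail_commg_core i).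
have sMW : M \subset W := subset_trans sMcore (core_sub i).
have nMW : W \subset 'N(M) by rewrite normsR ?tail_norm.
have layerM j : (i < j)%N -> L (p ^ j - p ^ i) \subset layer j M.
  move=> lt_ij; have Tg := subsetP sNT _ Ng.
  have [u uL low] := tail_not_lower lt_ij Tg nTg.
  have [E | gt0] := posnP (p ^ j - p ^ i).
    apply/subsetP=> v; rewrite E stratum0 => /eqP->; apply/layerP.
    by exists 1%g; rewrite !group1 diff1.
  rewrite -(prednK gt0); apply: layer_stratum low => //.
  have /baseB_layer[t /setIP[_ Tt] tX] : u \in depends j.
    by rewrite depends_stratum // ltnW.
  have Wg := subsetP (tail_sub p n i) _ Tg.
  apply/layerP; exists [~ t, g^-1]%g; split.
  - by rewrite -groupV invg_comm mem_commg ?groupV // (subsetP (tail_leq p n lt_ij)).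
  - rewrite commgEl groupM ?groupV // memJ_norm // groupV.
    exact: (subsetP (tail_norm p n j)).
  by rewrite diffR_tail ?groupV // invgK tX eqxx.
(* An element of the core is divided by elements of [M], one level at a time. *)
have sub l : (i < l <= n)%N -> core i \subset (M * tail l)%g.
  elim: l => [|l IH] /andP[]; first by [].
  rewrite ltnS leq_eqVlt => /predU1P[<- _ | lt_il lt_ln].
    by apply: (subset_trans (core_sub_tail i)); rewrite mulG_subr.
  pose j := Ordinal lt_ln.
  apply/subsetP=> d cd.
  have sub_l : core i \subset (M * tail l)%g by apply: IH; rewrite lt_il ltnW.
  have /mulsgP[m t Mm Tt Ed] := subsetP sub_l d cd.
  have ct : t \in core i.
    have -> : t = (m^-1 * d)%g by rewrite Ed mulKg.
    by apply: (groupM _ cd); rewrite groupV; apply: (subsetP sMcore).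
  have /coreP[Wt /(_ j)/(subsetP (layerM j lt_il))/layerP[m' [Mm' Tm' Em']]] := ct.
  have Tt' : (m'^-1 * t)%g \in tail l.+1.
    rewrite (tailS j) groupM ?groupV //=.
    by rewrite diffM_tail ?groupV // diffV_tail // Em' addNr.
  have -> : d = (m * m' * (m'^-1 * t))%g by rewrite Ed -mulgA mulKVg.
  by apply: mem_mulg Tt'; apply: (@groupM _ [~: N, tail i.+1]%G).
have := sub n; rewrite tail_full mulg1; apply.
by rewrite ltn_ord leqnn.
Qed.

(** Each of the [n - i] layers of the core has codimension at most [p ^ i]. *)
Lemma card_tail_core i :
  (#|tail i| <= (p ^ (p ^ i)) ^ (n - i) * #|core i|)%N.
Proof.
have step d : (d <= n - i)%N ->
  (#|tail (n - d)| <= (p ^ (p ^ i)) ^ d * #|core i :&: tail (n - d)|)%N.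
  elim: d => [|d IH] lt_d.
    by rewrite subn0 tail_full mul1n (setIidPr _) ?sub1G.
  have lt_n : (n - d.+1 < n)%N by lia.
  pose j := Ordinal lt_n.
  have jS : (n - d = j.+1)%N by rewrite /=; lia.
  have := IH (ltnW lt_d); rewrite jS -[(n - d.+1)%N]/(nat_of_ord j) => {}IH.
  have cardW := @card_layer j (triangular_group p n) (subxx _).
  have cardC := @card_layer j (core_group i) (core_sub i).
  rewrite /= !(setIidPr (tail_sub _ _ _)) in cardW.
  rewrite cardW cardC expnS [X in (_ <= X)%N]mulnACA leq_mul //.
  have sLc : L (p ^ j - p ^ i) \subset layer j (core i).
    apply/subsetP=> u uL; have /baseB_layer[b /setIP[_ Tb] bX] : u \in depends j.
      rewrite depends_stratum ?(ltnW lt_n) //; exact: stratum_leq (leq_subr _ _) uL.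
    apply/layerP; exists b; rewrite bX eqxx; split=> //; apply/coreP.
    split=> [|l]; first exact: (subsetP (tail_sub p n j)).
    by rewrite bX; case: eqP => [-> | _] //; apply: stratum_zero.
  have sWL : layer j W \subset L (p ^ j).
    rewrite -depends_stratum ?(ltnW lt_n) //.
    by apply/subsetP=> u; apply: (@layer_depends j (triangular_group p n)).
  apply: leq_trans (subset_leq_card sWL) _.
  apply: (@leq_trans (p ^ (p ^ i) * #|L (p ^ j - p ^ i)|)).
    rewrite -{1}(subnKC (_ : p ^ i <= p ^ j)%N) ?card_stratum_leq //.
    by rewrite leq_pexp2l ?prime_gt0 //=; lia.
  by rewrite leq_mul2l subset_leq_card ?orbT.
have := step (n - i)%N (leqnn _); rewrite subKn; last exact: ltnW.
move/leq_trans; apply; rewrite leq_mul2l subset_leq_card ?orbT //.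
exact: subsetIl.
Qed.

(** The [p ^ i - 1]-fold difference of the indicator of zero on level [i] is the
    constant 1, and differences are realised by commutators with the
    odometer. *)
Lemma lcn_tail_not_sub i : ~~ ('L_(p ^ i)(W) :&: tail i \subset tail i.+1).
Proof.
have descend c : exists2 t, t \in 'L_c.+1(W) :&: tail i &
    diff t (X i) = iter c (diff s) (fibre i (0 : vec)).
  elim: c => [|c [t /setIP[Lt Tt] tX]].
    have [t /setIP[_ Tt] tX] := baseB_layer (depends_fibre i (0 : vec)).
    by exists t; rewrite ?tX ?eqxx // lcn1 inE Tt (subsetP (tail_sub p n i)).
  exists [~ t, s^-1]%g; last by rewrite diffR_tail ?groupV // invgK tX.
  rewrite inE lcnSn mem_commg ?groupV //= commgEl groupM ?groupV //.
  by rewrite memJ_norm // groupV (subsetP (tail_norm p n i)).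
have [t Lt tX] := descend (p ^ i).-1; rewrite prednK // in Lt.
apply/subsetPn; exists t => //; rewrite tailS negb_and tX; apply/orP; right.
have := @iter_diff_fibre i i 1 (0 : vec).
rewrite leqnn (ltnW (ltn_ord i)) mulr1 subnn subn1 => /(_ isT) E.
by apply: contra_eq_neq E => ->; rewrite !ffunE eq_sym oner_eq0.
Qed.

(** The core is obtained from a normal subgroup inside the term [p ^ i] of the
    lower central series, so it lies in the next term. *)
Lemma lcn_eq_core i : 'L_(p ^ i).+1(W) = core i.
Proof.
apply/eqP; rewrite eqEsubset lcn_core /= -(prednK (pX_gt0 i)) lcnSn prednK //.
pose N := ('L_(p ^ i)(W) :&: tail i)%G.
have nNW : W \subset 'N(N) by rewrite normsI ?tail_norm ?normal_norm ?lcn_normal.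
apply: (subset_trans (core_sub_commg nNW (subsetIr _ _) (lcn_tail_not_sub i))).
by rewrite commgSS ?subsetIl ?tail_sub.
Qed.

Lemma normal_lcn i N : N <| W -> N \subset tail i -> ~~ (N \subset tail i.+1) ->
  'L_(p ^ i).+1(W) \subset N /\
  (#|N : 'L_(p ^ i).+1(W)| <= (p ^ (p ^ i)) ^ (n - i))%N.
Proof.
move=> /andP[sNW nNW] sNT nsNT; rewrite lcn_eq_core.
have sCN : core i \subset N.
  apply: subset_trans (core_sub_commg nNW sNT nsNT) _.
  by rewrite commg_subl (subset_trans (tail_sub _ _ _)).
split=> //; rewrite -(@divgS _ N (core_group i) sCN) /=.
apply: leq_trans (leq_div2r _ (leq_trans (subset_leq_card sNT) (card_tail_core i))) _.
by rewrite mulnK // (cardG_gt0 (core_group i)).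
Qed.

End LowerCentral.

Theorem corollary4p8 (n : nat) (hn : 1 <= n) :
  exists F : nat -> nat -> nat,
    forall (p k : nat) (N : {group {perm 'rV['F_p]_n}}),
      prime p -> odd p -> 1 <= k -> k <= n ->
      N <| iterW p n ->
      N \subset tailB p n k ->
      ~~ (N \subset tailB p n k.+1) ->
      [/\ 'L_(p ^ (k - 1) + 1)(iterW p n) \subset N,
          #|N : 'L_(p ^ (k - 1) + 1)(iterW p n)|
            <= (p ^ (p ^ (k - 1))) ^ (n - k + 1)
        & #|N : 'L_(p ^ (k - 1) + 1)(iterW p n)| <= F p k].
Proof.
case: n hn => // n' _.
exists (fun p k : nat => (p ^ (p ^ (k - 1))) ^ (n'.+1 - k + 1))%N.
move=> p [//|k] N p_pr _ _ lt_kn; rewrite !tailB_tail ?(ltnW lt_kn) //.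
rewrite iterW_triangular // => nNW sNT nsNT.
have -> : (n'.+1 - k.+1 + 1 = n'.+1 - k)%N by lia.
rewrite subn1 addn1 /=.
have [s Ws sX] := odometer_exists p n'.+1.
have [] := @normal_lcn p n' p_pr s Ws sX (Ordinal lt_kn) N nNW sNT nsNT.
by split.
Qed.
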